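(* Let $G=(V,E)$ be a simple undirected graph. Let $S_h=\{h\}\cup I$ and $S_u=\{u\}\cup I$ be two sets of vertices inducing star subgraphs in $G$, where $h$ and $u\in V\setminus N[h]$ are two (non-adjacent) hub vertices and $I$, $|I|\ge 2$, is the joint set of leaves. Then the inequalities $$\sum_{i\in I}x_i+(|I|-1)x_h+x_u\le |I|\qquad\text{and}\qquad\sum_{i\in I}x_i+x_h+(|I|-1)x_u\le |I|$$ induce facets of $\mathscr{P}_{IUC}(G)$.
   Context: All graphs are finite, simple and undirected; $N(h)$ is the set of vertices adjacent to $h$ and $N[h]=N(h)\cup\{h\}$. A subset $U\subseteq V$ of the vertices of $G=(V,E)$ is an independent union of cliques (IUC) if every connected component of the induced subgraph $G[U]$ is a complete graph (equivalently, $G[U]$ has no induced path on three vertices). The IUC polytope $\mathscr{P}_{IUC}(G)\subseteq\mathbb{R}^{V}$ is the convex hull of the incidence vectors of all IUCs of $G$. A set $\{h\}\cup I$ ($h\notin I$) induces a star graph with hub $h$ and leaves $I$ if $h$ is adjacent to every vertex of $I$ and $I$ is an independent set. *)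

(* Defs.v *)
From HB Require Import structures.
From mathcomp Require Import all_boot all_order all_algebra.
Set Implicit Arguments.
Unset Strict Implicit.
Unset Printing Implicit Defensive.
Import Order.TTheory GRing.Theory Num.Theory.
Local Open Scope ring_scope.

Section Graphs.
Variable V : finType.

Record sgraph := SGraph {
  adj :> rel V;
  adj_sym : symmetric adj;
  adj_irrefl : irreflexive adj }.

Variable G : sgraph.

Definition nbh (h : V) : {set V} := [set v | G h v].

Definition closed_nbh (h : V) : {set V} := h |: nbh h.

Definition clique (C : {set V}) : Prop :=
  {in C &, forall x y, x != y -> G x y}.

Definition independent (I : {set V}) : Prop :=
  {in I &, forall x y, ~~ G x y}.

Definition induced_adj (U : {set V}) : rel V :=
  [rel x y | [&& x \in U, y \in U & G x y]].

Definition components (U : {set V}) : {set {set V}} :=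
  equivalence_partition (connect (induced_adj U)) U.

Definition IUC (U : {set V}) : Prop :=
  forall C : {set V}, C \in components U -> clique C.

Definition induces_star (h : V) (I : {set V}) : Prop :=
  [/\ h \notin I, {in I, forall i, G h i} & independent I].

End Graphs.

Section Polyhedra.
Variables (R : realFieldType) (E : vectType R).

Definition convex_hull (A : E -> Prop) : E -> Prop := fun x =>
  exists (n : nat) (w : 'I_n -> R) (p : 'I_n -> E),
    [/\ forall i, 0 <= w i, \sum_i w i = 1, forall i, A (p i)
      & x = \sum_i w i *: p i].

Definition affinely_independent (s : seq E) : bool :=
  if s is x :: s' then free [seq y - x | y <- s'] else true.

(* Affine dimension, as one less than the maximal number of affinely
   independent points of A; A is nonempty since d is a natural number. *)
Definition has_dim (A : E -> Prop) (d : nat) : Prop :=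
  (exists s : seq E, [/\ size s = d.+1, affinely_independent s
                       & forall y, y \in s -> A y]) /\
  (forall s : seq E, affinely_independent s -> (forall y, y \in s -> A y) ->
     (size s <= d.+1)%N).

(* The inequality f x <= b is valid for P, and the face of P on which it is
   tight has dimension dim P - 1. *)
Definition induces_facet (P : E -> Prop) (f : E -> R^o) (b : R) : Prop :=
  [/\ linear f,
      forall x, P x -> f x <= b
    & exists d : nat, has_dim (fun x => P x /\ f x = b) d /\ has_dim P d.+1].

End Polyhedra.

Section IUCPolytope.
Variables (R : realFieldType) (V : finType).

(* The codomain is R^o, rather than R, so that the space R^V of functions
   inherits the vectType R structure. *)
Definition incidence (U : {set V}) : {ffun V -> R^o} :=
  [ffun v => (v \in U)%:R].

Definition IUC_polytope (G : sgraph V) : {ffun V -> R^o} -> Prop :=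
  convex_hull (fun x => exists2 U : {set V}, IUC G U & x = incidence U).

End IUCPolytope.

(* Main.v *)
Require Import Defs.
From HB Require Import structures.
From mathcomp Require Import all_boot all_order all_algebra.
From mathcomp Require Import ring lra.
Set Implicit Arguments.
Unset Strict Implicit.
Unset Printing Implicit Defensive.
Import Order.TTheory GRing.Theory Num.Theory.
Local Open Scope ring_scope.

(** An IUC containing a hub contains at most one of its leaves, and an IUC
    containing both hubs contains none, which gives validity. The IUCs [I],
    [{h, u}] and [{h, i}] for [i] in [I] are tight, and each vertex [v] outside
    [I], [h], [u] extends one of them to an IUC: [{h, u}] if [v] is not adjacent
    to both hubs, otherwise [{h, i}] if [v] is adjacent to some leaf [i], and
    [I] if it is adjacent to none. The #|V| incidence vectors obtained in this
    way are linearly independent. *)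

(** * Independent unions of cliques through three-vertex paths *)

Section InducedPaths.
Variables (V : finType) (G : sgraph V).
Implicit Types U : {set V}.

(** Replaces components by a condition on triples. In one direction, [x] and [z] both lie in the
    component of [y]. *)
Lemma IUC_P3 U : IUC G U <->
  (forall x y z, x \in U -> y \in U -> z \in U ->
     G x y -> G y z -> x != z -> G x z).
Proof.
split=> [iucU x y z xU yU zU xy yz | noP3 C /imsetP[w wU ->] x y].
  apply: (iucU [set t in U | connect (induced_adj G U) y t]).
  - exact: imset_f.
  - by rewrite inE xU connect1 //= /induced_adj /= yU xU adj_sym.
  - by rewrite inE zU connect1 //= /induced_adj /= yU zU.
(* Each new edge of a path from [w] is shortcut by the hypothesis on triples, so the path never
   leaves [w] and its neighbours. *)
have conn t : connect (induced_adj G U) w t -> w = t \/ G w t.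
  case/connectP=> p; elim/last_ind: p t => [|p t IHp] t' /=; first by left.
  rewrite rcons_path last_rcons => /andP[wp /and3P[lU tU lt]] ->.
  case: (IHp _ wp erefl) => [wl | wl]; first by right; rewrite {1}wl.
  by case: (eqVneq w t) => wt; [left | right; apply: noP3 wl lt wt].
rewrite !inE => /andP[xU /conn wx] /andP[yU /conn wy] xy.
case: wx wy xy => [<- | wx] [<- | wy]; rewrite ?eqxx // 1?adj_sym //.
by rewrite eq_sym => yx; apply: (noP3 y w x) => //; rewrite adj_sym.
Qed.

Lemma clique_IUC U : clique G U -> IUC G U.
Proof. by move=> cU; apply/IUC_P3=> x y z xU _ zU _ _; apply: cU. Qed.

Lemma independent_IUC U : independent G U -> IUC G U.
Proof.
move=> indU; apply/IUC_P3=> x y z xU yU _ xy.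
by rewrite (negbTE (indU _ _ xU yU)) in xy.
Qed.

(** As [a] and [b] are not adjacent, an induced path on these vertices could only have [v] in the
    middle. *)
Lemma IUC_nonadjacent_setU1 a b v :
  ~~ G a b -> ~~ (G v a && G v b) -> IUC G (v |: [set a; b]).
Proof.
move=> ab vab; apply/IUC_P3=> x y z.
have loop := adj_irrefl G; have ba := ab; rewrite adj_sym in ba.
rewrite !inE => /or3P[] /eqP-> /or3P[] /eqP-> /or3P[] /eqP->;
  rewrite ?eqxx ?loop ?(negbTE ab) ?(negbTE ba) // => xv vz _;
  by move: vab; rewrite ?xv ?vz // adj_sym ?xv ?vz // andbC adj_sym ?xv ?vz.
Qed.

Lemma IUC_pair a b : IUC G [set a; b].
Proof.
apply/IUC_P3=> x y z.
by rewrite !inE => /orP[] /eqP-> /orP[] /eqP-> /orP[] /eqP->;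
  rewrite ?eqxx ?adj_irrefl.
Qed.

(** Two leaves in [U] would form an induced path with the hub as middle vertex. *)
Lemma IUC_hub_leaves_le1 U h (I : {set V}) :
  induces_star G h I -> IUC G U -> h \in U -> (#|I :&: U| <= 1)%N.
Proof.
move=> [_ hI indI] /IUC_P3 noP3 hU; apply/card_le1_eqP=> i j.
rewrite !inE => /andP[iI iU] /andP[jI jU]; apply/eqP/contraT=> ij.
rewrite eq_sym in ij; have := indI _ _ iI jI.
by rewrite (noP3 i h j) // 1?eq_sym ?hI // adj_sym hI.
Qed.

End InducedPaths.

(** * Affine dimension and a criterion for facets *)

Section Facets.
Variables (R : realFieldType) (V : finType).
Local Notation E := {ffun V -> R^o}.

(** Lets freeness be proved with coefficients indexed by vertices instead of ordinals. *)
Lemma free_family (p : V -> E) :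
    (forall k : V -> R, \sum_v k v *: p v = 0 -> forall v, k v = 0) ->
  free [seq p v | v <- enum V].
Proof.
move=> inj_p; apply/(@freeP _ _ _ [tuple of map p (enum_tuple V)])=> k k0 i.
have -> : k i = (k \o enum_rank) (enum_val i) by rewrite /= enum_valK.
apply: inj_p; rewrite (reindex _ (onW_bij _ (@enum_val_bij V))) /= -[RHS]k0.
apply: eq_bigr => j _; rewrite enum_valK (nth_map (enum_val j)) -?cardE //.
by rewrite -enum_val_nth.
Qed.

Lemma free_affinely_independent (s : seq E) : free s -> affinely_independent s.
Proof.
case: s => //= x s; rewrite free_cons => /andP[xs fs].
apply/(@freeP _ _ _ [tuple of [seq y - x | y <- in_tuple s]])=> k k0.
have {}k0 : \sum_i k i *: s`_i = (\sum_i k i) *: x.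
  apply/eqP; rewrite -subr_eq0 -[X in _ == X]k0 scaler_suml -sumrB.
  by apply/eqP/eq_bigr=> i _; rewrite (nth_map 0) // scalerBr.
(* A nonzero sum of coefficients would put [x] in the span of the other vectors. *)
have k_sum : \sum_i k i = 0.
  apply: contraNeq xs => nz; rewrite -[x](scalerK nz) -k0 memvZ //.
  by apply: memv_suml => i _; rewrite memvZ // memv_span // mem_nth.
by apply: (@freeP _ _ _ (in_tuple s) fs); rewrite k0 k_sum scale0r.
Qed.

Lemma dim_ffun : \dim {:E} = #|V|.
Proof. by rewrite dimvf /dim /= muln1. Qed.

Lemma affinely_independent_size (U : {vspace E}) (s : seq E) :
    affinely_independent s -> {in s &, forall x y, y - x \in U} ->
  (size s <= (\dim U).+1)%N.
Proof.
case: s => //= x s; rewrite /free size_map ltnS => /eqP<- sU.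
apply/dimvS/span_subvP=> _ /mapP[y ys ->].
by apply: sU; rewrite inE ?eqxx // ys orbT.
Qed.

(** Containing the origin and the unit vectors, [P] has dimension [#|V|]. The free tight points
    bound the dimension of the face below by [#|V| - 1]. Differences of tight points lie in the
    kernel of [f], a proper subspace since [f] takes the value [b != 0]; this gives the upper
    bound. *)
Lemma free_tight_facet (P : E -> Prop) (f : E -> R^o) (b : R) (p : V -> E) :
    linear f -> (forall x, P x -> f x <= b) -> b != 0 -> (0 < #|V|)%N ->
    P 0 -> (forall v, P (incidence R [set v])) ->
    (forall v, P (p v)) -> (forall v, f (p v) = b) ->
    free [seq p v | v <- enum V] ->
  induces_facet P f b.
Proof.
move=> flin fP b0 V0 P0 Pe Pp fp frp; split=> //.
pose g : {linear E -> R^o} := HB.pack f (GRing.isLinear.Build R E R^o *:%R f flin).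
(* Non-emptiness of [V] makes the truncated predecessor exact. *)
exists #|V|.-1; rewrite prednK //; split; split.
- exists [seq p v | v <- enum V]; split.
  + by rewrite size_map -cardE prednK.
  + exact: free_affinely_independent.
  + by move=> _ /mapP[v _ ->].
- move=> s sind sP; rewrite prednK //.
  have kerlt : (\dim (lker (linfun g)) < #|V|)%N.
    rewrite -dim_ffun ltn_neqAle dimvS ?subvf // andbT.
    apply: contra b0 => /eqP dimk; have v : V by have /card_gt0P/sigW[] := V0.
    have : p v \in lker (linfun g).
      by rewrite (eqP (_ : lker _ == fullv)) ?memvf // eqEdim subvf dimk /=.
    by rewrite memv_ker lfunE /= fp.
  apply: leq_trans kerlt; apply: affinely_independent_size => // x y xs ys.
  rewrite memv_ker lfunE raddfB /=.
  by rewrite (sP x xs).2 (sP y ys).2 subrr.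
- exists (0 :: [seq incidence R [set v] | v <- enum V]); split.
  + by rewrite /= size_map -cardE.
  + rewrite /= -map_comp (eq_map (_ : _ =1 fun v => incidence R [set v])).
      apply: free_family => k /ffunP k0 v; have := k0 v.
      rewrite sum_ffunE (bigD1 v) //= big1 => [|w wv].
        by rewrite addr0 !ffunE inE eqxx => <-; rewrite [RHS]mulr1.
      by rewrite !ffunE inE eq_sym (negbTE wv) scaler0.
    by move=> v /=; rewrite subr0.
  + by move=> y; rewrite inE => /predU1P[-> // | /mapP[v _ ->]].
- move=> s sind _; rewrite -dim_ffun.
  by apply: affinely_independent_size => // x y _ _; rewrite memvf.
Qed.

End Facets.

(** * The double star inequality with the large coefficient at [h] *)

Section DoubleStar.
Variables (R : realFieldType) (V : finType) (G : sgraph V).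
Variables (h u : V) (I : {set V}).
Hypotheses (hStar : induces_star G h I) (uStar : induces_star G u I).
Hypotheses (hu : h != u) (huG : ~~ G h u) (hI : (2 <= #|I|)%N).
(** Known only through [fE], [f] can also be the left-hand side with the hubs exchanged and its
    summands in another order. *)
Variable f : {ffun V -> R^o} -> R^o.
Hypothesis fE :
  forall x, f x = \sum_(i in I) x i + (#|I|%:R - 1) * x h + x u.

Let hNI : h \notin I. Proof. by case: hStar. Qed.
Let uNI : u \notin I. Proof. by case: uStar. Qed.

Lemma double_star_linear : linear f.
Proof.
move=> a x y; rewrite !fE !ffunE.
under eq_bigr do rewrite !ffunE.
rewrite big_split -scaler_sumr /= /GRing.scale /=.
ring.
Qed.

Lemma double_star_incidence (U : {set V}) :
  f (incidence R U) =
    #|I :&: U|%:R + (#|I|%:R - 1) * (h \in U)%:R + (u \in U)%:R.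
Proof.
rewrite fE !ffunE; congr (_ + _ + _).
under eq_bigr do rewrite ffunE.
rewrite -natr_sum -sum1_card -big_mkcondr; congr _%:R.
by apply: eq_bigl => i; rewrite inE.
Qed.

Lemma double_star_incidenceU1 v (U : {set V}) :
    v \notin I -> v != h -> v != u ->
  f (incidence R (v |: U)) = f (incidence R U).
Proof.
move=> vI vh vu; rewrite !fE !ffunE !in_setU1.
rewrite (eq_sym h) (negbTE vh) (eq_sym u) (negbTE vu).
congr (_ + _ + _); apply: eq_bigr => i iI; rewrite !ffunE in_setU1.
by case: eqP iI vI => // -> ->.
Qed.

Lemma double_star_valid (U : {set V}) :
  IUC G U -> f (incidence R U) <= #|I|%:R.
Proof.
move=> iucU; rewrite double_star_incidence.
(* Used when [U] contains [u] but not [h]: then [u] and at most one leaf contribute at most 2. *)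
have le1_I : 1 + 1 <= #|I|%:R :> R by rewrite -(natrD _ 1 1) ler_nat.
have le1 w : induces_star G w I -> w \in U -> #|I :&: U|%:R <= 1 :> R.
  by move=> wS wU; rewrite lern1 (IUC_hub_leaves_le1 wS iucU).
have [hU | _] := boolP (h \in U); have [uU | _] := boolP (u \in U).
(* A leaf [i] in [U] would give the induced path [h], [i], [u]. *)
- suff -> : I :&: U = set0 by rewrite cards0 /= mulr1 add0r subrK.
  apply/setP=> i; rewrite !inE; apply/negP=> /andP[iI iU].
  have /IUC_P3 noP3 := iucU; move/negP: huG; apply; apply: (noP3 h i u) => //.
    by case: hStar => _ ->.
  by rewrite adj_sym; case: uStar => _ ->.
- by have := le1 _ hStar hU; rewrite /= mulr1 addr0; lra.
- by have := le1 _ uStar uU; rewrite /= mulr0 addr0 -[true%:R]/1; lra.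
- by rewrite mulr0 !addr0 ler_nat subset_leq_card ?subsetIl.
Qed.

Lemma double_star_tight_leaves : f (incidence R I) = #|I|%:R.
Proof.
by rewrite double_star_incidence setIid (negbTE hNI) (negbTE uNI) mulr0 !addr0.
Qed.

Lemma double_star_tight_hubs : f (incidence R [set h; u]) = #|I|%:R.
Proof.
rewrite double_star_incidence !inE !eqxx orbT.
suff -> : I :&: [set h; u] = set0 by rewrite cards0 mulr1 add0r subrK.
apply/setP=> i; rewrite !inE; apply/negP=> /andP[iI].
by case/orP=> /eqP iw; move: iI; rewrite iw ?(negbTE hNI) ?(negbTE uNI).
Qed.

Lemma double_star_tight_edge i :
  i \in I -> f (incidence R [set h; i]) = #|I|%:R.
Proof.
move=> iI; have ui : u != i by apply: contraNneq uNI => ->.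
rewrite double_star_incidence !inE eqxx (eq_sym u h) (negbTE hu) (negbTE ui) /=.
suff -> : I :&: [set h; i] = [set i] by rewrite cards1 mulr1 addr0 subrKC.
apply/setP=> j; rewrite !inE; case: (eqVneq j h) => [->|_] /=.
  rewrite (negbTE hNI); apply/esym; apply: contraNF hNI => /eqP->//.
by case: eqP => [->|]; rewrite ?iI ?andbF.
Qed.

(** The last conjunct prepares the elimination in the proof of linear independence: a vertex outside
    [I], [h], [u] belongs to its own set and to no other. *)
Lemma double_star_tight_IUC v : exists U : {set V},
  [/\ IUC G U, f (incidence R U) = #|I|%:R
    & if v \in I then U = [set h; v] else if v == h then U = [set h; u]
      else if v == u then U = I
      else v \in U /\ U \subset v |: (h |: (u |: I))].
Proof.
have [_ hIG indI] := hStar.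
have [vI | vI] := boolP (v \in I).
  by exists [set h; v]; split; [exact: IUC_pair | exact: double_star_tight_edge |].
have [_ | vh] := eqVneq v h.
  by exists [set h; u]; split; [exact: IUC_pair | exact: double_star_tight_hubs |].
have [_ | vu] := eqVneq v u.
  exists I; split=> //; [exact: independent_IUC | exact: double_star_tight_leaves].
have [/andP[vhG vuG] | vhu] := boolP (G v h && G v u); last first.
  exists (v |: [set h; u]); split; first exact: IUC_nonadjacent_setU1.
    by rewrite double_star_incidenceU1 // double_star_tight_hubs.
  split; first exact: setU11.
  by apply/subsetP=> w; rewrite !inE => /or3P[] ->; rewrite ?orbT.
have [/exists_inP[i iI vi] | /exists_inPn noI] := boolP [exists i in I, G v i].
  (* Here [v], [h] and [i] are pairwise adjacent. *)
  have hi := hIG i iI; exists (v |: [set h; i]); split.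
  - apply: clique_IUC => x y.
    rewrite !inE => /or3P[] /eqP-> /or3P[] /eqP->; rewrite ?eqxx // => _;
      by rewrite // adj_sym.
  - by rewrite double_star_incidenceU1 // double_star_tight_edge.
  - split; first exact: setU11.
    by apply/subsetP=> w; rewrite !inE => /or3P[] /eqP->; rewrite ?iI ?eqxx ?orbT.
exists (v |: I); split.
- apply: independent_IUC => x y.
  rewrite !inE => /predU1P[-> | xI] /predU1P[-> | yI]; rewrite ?adj_irrefl //.
  + exact: noI.
  + by rewrite adj_sym noI.
  + exact: indI.
- by rewrite double_star_incidenceU1 // double_star_tight_leaves.
- split; first exact: setU11.
  by apply/subsetP=> w; rewrite !inE => /orP[] ->; rewrite ?orbT.
Qed.

(** Linear independence is shown by elimination in a vanishing combination. Coefficients of outside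
    vertices vanish first. Then coordinate [u] gives [k h = 0], each leaf [i] gives [k i = - k u],
    and coordinate [h] leaves [#|I|] times [- k u] equal to 0. *)
Lemma double_star_facet : induces_facet (@IUC_polytope R V G) f #|I|%:R.
Proof.
have gen (U : {set V}) : IUC G U -> @IUC_polytope R V G (incidence R U).
  move=> iucU; exists 1, (fun=> 1), (fun=> incidence R U).
  by split=> //; rewrite ?big_ord1 ?scale1r //; exists U.
have single w : IUC G [set w] by rewrite -[[set w]]setUid; exact: IUC_pair.
have I0 : #|I|%:R != 0 :> R by rewrite pnatr_eq0 -lt0n ltnW.
have [T TP] := fin_all_exists double_star_tight_IUC.
apply: (free_tight_facet (p := fun v => incidence R (T v))) => //.
- exact: double_star_linear.
- move=> _ [n [w [p [w0 w1 pP ->]]]].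
  pose g : {linear {ffun V -> R^o} -> R^o} :=
    HB.pack f (GRing.isLinear.Build R _ R^o *:%R f double_star_linear).
  rewrite -[f _]/(g _) linear_sum.
  have -> : #|I|%:R = \sum_i w i * #|I|%:R by rewrite -mulr_suml w1 mul1r.
  apply: ler_sum => i _; rewrite linearZ ler_wpM2l //=.
  by have [U iucU ->] := pP i; apply: double_star_valid.
- by apply/card_gt0P; exists h.
- have -> : 0 = incidence R (set0 : {set V}).
    by apply/ffunP=> v; rewrite !ffunE inE.
  by apply/gen/clique_IUC => x y; rewrite inE.
- by move=> v; apply: gen.
- by move=> v; apply: gen; case: (TP v).
- by move=> v; case: (TP v).
apply: free_family => k /ffunP k0.
have {}k0 w : \sum_v k v * (w \in T v)%:R = 0.
  by have := k0 w; rewrite sum_ffunE ffunE; under eq_bigr do rewrite !ffunE.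
have TI v : v \in I -> T v = [set h; v] by case: (TP v) => _ _; case: ifP.
have Th : T h = [set h; u].
  by case: (TP h) => _ _; rewrite (negbTE hNI) eqxx.
have Tu : T u = I.
  by case: (TP u) => _ _; rewrite (negbTE uNI) eq_sym (negbTE hu) eqxx.
have Tout v : v \notin h |: (u |: I) ->
    v \in T v /\ T v \subset v |: (h |: (u |: I)).
  rewrite !inE !negb_or => /and3P[vh vu vI]; case: (TP v) => _ _.
  by rewrite (negbTE vh) (negbTE vu) (negbTE vI).
have kout v : v \notin h |: (u |: I) -> k v = 0.
  move=> vS; have [vT _] := Tout v vS.
  rewrite -[RHS](k0 v) (bigD1 v) //= vT mulr1 big1 ?addr0 // => w wv.
  (* [T w] lies within the hubs and leaves, plus [w] itself if [w] is outside them. *)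
  suff /negbTE-> : v \notin T w by rewrite mulr0.
  have [wS | /Tout[_ /subsetP Tw]] := boolP (w \in h |: (u |: I)); last first.
    by apply: contra vS => /Tw; rewrite in_setU1 eq_sym (negbTE wv).
  apply: contra vS; move: wS; rewrite !inE => /or3P[/eqP-> | /eqP-> | wI].
  - by rewrite Th !inE => /orP[] ->; rewrite ?orbT.
  - by rewrite Tu => ->; rewrite !orbT.
  - by rewrite TI // !inE => /orP[/eqP-> | /eqP->]; rewrite ?eqxx ?wI ?orbT.
have sumS w : \sum_(v in I) k v * (w \in T v)%:R + k h * (w \in T h)%:R
    + k u * (w \in T u)%:R = 0.
  rewrite -[RHS](k0 w) [RHS](bigID (mem (h |: (u |: I)))) /=.
  rewrite [X in _ = _ + X]big1 => [|v /kout->]; last by rewrite mul0r.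
  rewrite !big_setU1 ?inE ?negb_or ?hu //= addr0.
  by rewrite [RHS]addrCA [RHS]addrC; congr (_ + _); rewrite addrC.
have kh : k h = 0.
  rewrite -[RHS](sumS u) Th Tu (negbTE uNI) !inE eqxx orbT mulr1 mulr0 addr0.
  rewrite big1 ?add0r // => i iI; rewrite TI // !inE eq_sym (negbTE hu).
  by case: eqP uNI => [->|_ _]; rewrite ?iI ?mulr0.
have kI i : i \in I -> k i = - k u.
  move=> iI; apply/eqP; rewrite -addr_eq0 -[X in _ == X](sumS i) kh mul0r addr0.
  rewrite Tu iI mulr1 (bigD1 i) //= TI // !inE eqxx orbT mulr1 big1 ?addr0 //.
  move=> j /andP[jI ji]; rewrite TI // !inE eq_sym [i == j]eq_sym (negbTE ji).
  by case: eqP hNI => [->|_ _]; rewrite ?iI ?mulr0.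
have ku : k u = 0.
  apply/eqP; have := sumS h; rewrite kh mul0r Tu (negbTE hNI) mulr0 !addr0.
  rewrite (eq_bigr (fun=> - k u)) => [|i iI].
    rewrite sumr_const -mulr_natr mulNr => /eqP.
    by rewrite oppr_eq0 mulf_eq0 (negbTE I0) orbF.
  by rewrite TI // !inE eqxx mulr1 kI.
move=> v; have [|/kout//] := boolP (v \in h |: (u |: I)).
by rewrite !inE => /or3P[/eqP->|/eqP->|/kI->] //; rewrite ku oppr0.
Qed.

End DoubleStar.

Theorem theorem9 (R : realFieldType) (V : finType) (G : sgraph V)
    (h u : V) (I : {set V})
    (hStar : induces_star G h I) (uStar : induces_star G u I)
    (hu : u \notin closed_nbh G h) (hI : (2 <= #|I|)%N) :
  induces_facet (@IUC_polytope R V G)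
    (fun x => \sum_(i in I) x i + (#|I|%:R - 1) * x h + x u) #|I|%:R /\
  induces_facet (@IUC_polytope R V G)
    (fun x => \sum_(i in I) x i + x h + (#|I|%:R - 1) * x u) #|I|%:R.
Proof.
move: hu; rewrite !inE negb_or => /andP[uh huG].
split; first by apply: (double_star_facet hStar uStar); rewrite // eq_sym.
(* The hypotheses are symmetric in the two hubs. *)
apply: (double_star_facet uStar hStar); rewrite // 1?adj_sym // => x.
by rewrite addrAC.
Qed.
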